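(* Let $N\ge1$ be an integer, $\mathcal X=\{0,1,\dots,N\}$, $0<a,b,c<1$, and let, for $x,y\in\mathcal X$, $$K(x,y)=\sum_{z_2=0}^{\min(x,y)}\pi(z_2,y,a)\sum_{z_1=x+y-z_2}^{N}\pi(x-z_2,z_1-y,c)\,\pi(z_1-y,N-y,b),$$ where $\pi$ is the binomial measure. Then $K(x,y)\ge0$, $\sum_{x\in\mathcal X}K(x,y)=1$, and with $p=\dfrac{bc}{1-a+bc}$ one has, for all $x,y,n\in\mathcal X$, $$K(x,y)\,\pi(y,N,p)=K(y,x)\,\pi(x,N,p),$$ $$\sum_{y\in\mathcal X}K(x,y)\,\pi(y,N,p)\,\check P_n(y,p)=(a-bc)^n\,\pi(x,N,p)\,\check P_n(x,p).$$
   Context: $(a)_n=a(a+1)\cdots(a+n-1)$. Binomial (Krawtchouk) measure ($0<p<1$, integers $0\le x\le M$): $\pi(x,M,p)=\binom Mxp^x(1-p)^{M-x}$. Sums over empty ranges are zero. Krawtchouk polynomials on $\mathcal X$: $\check P_n(x,p)=\sum_{k=0}^n\frac{(-n)_k(-x)_k}{(-N)_k\,k!}p^{-k}$. *)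

(* Defs.v *)
From mathcomp Require Import all_boot all_order all_algebra.
Set Implicit Arguments.
Unset Strict Implicit.
Unset Printing Implicit Defensive.
Import Order.TTheory GRing.Theory Num.Theory.
Local Open Scope ring_scope.

Definition binomial_measure (R : realFieldType) (x M : nat) (p : R) : R :=
  'C(M, x)%:R * p ^+ x * (1 - p) ^+ (M - x).

Definition pochhammer (R : realFieldType) (a : R) (n : nat) : R :=
  \prod_(i < n) (a + i%:R).

(* The denominator (-N)_k is nonzero for k <= n <= N, which is the only range
   in which this is used. *)
Definition krawtchouk (R : realFieldType) (N n x : nat) (p : R) : R :=
  \sum_(0 <= k < n.+1)
    (pochhammer (- n%:R) k * pochhammer (- x%:R) k)
      / (pochhammer (- N%:R) k * k`!%:R) * p ^- k.

(* All the truncated subtractions are exact here: z2 <= minn x y and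
   x + y - z2 <= z1 <= N give z2 <= x, and y <= z1 <= N. *)
Definition kernelK (R : realFieldType) (N : nat) (a b c : R) (x y : nat) : R :=
  \sum_(0 <= z2 < (minn x y).+1)
    binomial_measure z2 y a *
    \sum_((x + y - z2)%N <= z1 < N.+1)
      binomial_measure (x - z2) (z1 - y) c *
      binomial_measure (z1 - y) (N - y) b.

(* Main.v *)
(** Summing out z1 (a thinning of a binomial is binomial) shows that K(x,y) is
    the coefficient of t^x in (1-a+at)^y (1-d+dt)^(N-y), where d = bc.
    Total mass is the value at t = 1. Detailed balance holds term by term in z2,
    because p(1-a) = (1-p)d. By detailed balance the eigenvalue equation becomes
    sum_y K(y,x) P_n(y) = (a-d)^n P_n(x); substituting t = 1+u, the binomial
    moments of K(.,x) are the coefficients of (1+au)^x (1+du)^(N-x), and the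
    generating function in n with weights C(N,n) w^n turns the left-hand side
    into (1+w-aw/p)^x (1+w-dw/p)^(N-x). That is the Krawtchouk generating function
    (1+v-v/p)^x (1+v)^(N-x) at v = (a-d)w. *)
Require Import Defs.
From mathcomp Require Import all_boot all_order all_algebra.
From mathcomp Require Import zify ring lra.
Set Implicit Arguments.
Unset Strict Implicit.
Unset Printing Implicit Defensive.
Import Order.TTheory GRing.Theory Num.Theory.
Local Open Scope ring_scope.

Section BinomialGeneratingFunction.

Variable R : realFieldType.
Implicit Types (a b c d p q : R).

(** * Binomial laws through their generating functions *)

Definition bernoulli_poly q : {poly R} := (1 - q)%:P + q *: 'X.

Lemma binomial_measure_ge0 q x M : 0 < q < 1 -> 0 <= binomial_measure x M q.
Proof.
move=> /andP[q0 q1]; rewrite /binomial_measure !mulr_ge0 ?exprn_ge0 ?ler0n //.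
  exact: ltW.
by rewrite subr_ge0 ltW.
Qed.

Lemma binomial_measure_small q x M : (M < x)%N -> binomial_measure x M q = 0.
Proof. by move=> ltMx; rewrite /binomial_measure bin_small // !mul0r. Qed.

Lemma coef_bernoulli_polyX q M i :
  (bernoulli_poly q ^+ M)`_i = binomial_measure i M q.
Proof.
rewrite /bernoulli_poly exprDn coef_sum.
have E (k : 'I_M.+1) :
    (((1 - q)%:P ^+ (M - k) * (q *: 'X) ^+ k) *+ 'C(M, k))`_i =
    binomial_measure k M q * (i == k)%:R.
  rewrite coefMn exprZn -rmorphXn /= coefCM coefZ coefXn /binomial_measure.
  by rewrite -mulr_natl; ring.
rewrite (eq_bigr _ (fun k _ => E k)).
have [ltiM|leMi] := ltnP i M.+1.
  rewrite (bigD1 (Ordinal ltiM)) //= eqxx mulr1 big1 ?addr0 // => k.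
  by rewrite -val_eqE /= eq_sym => /negPf ->; rewrite mulr0.
rewrite binomial_measure_small // big1 // => k _.
by rewrite gtn_eqF ?mulr0 //; apply: leq_trans (ltn_ord k) _.
Qed.

(** Composing the Bernoulli generating functions of [b] and [c] gives that of [b * c]. The sum over
    [j] is the binomial expansion of the [M]-th power of this composition, read at degree [i]. *)
Lemma binomial_thinning b c M i :
  \sum_(j < M.+1) binomial_measure i j c * binomial_measure j M b =
  binomial_measure i M (b * c).
Proof.
have E : bernoulli_poly (b * c) = (1 - b)%:P + b *: bernoulli_poly c.
  rewrite /bernoulli_poly -!mul_polyC !(rmorphB, rmorphM, rmorph1) /=; ring.
rewrite -[RHS]coef_bernoulli_polyX E exprDn coef_sum.
apply: eq_bigr => j _; rewrite coefMn exprZn -rmorphXn /= coefCM coefZ.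
by rewrite coef_bernoulli_polyX /binomial_measure -[RHS]mulr_natl; ring.
Qed.

(** * Closed form, positivity and total mass of the kernel *)

Lemma kernelKE N a b c x y : (y <= N)%N ->
  kernelK N a b c x y =
  \sum_(z < (minn x y).+1)
    binomial_measure z y a * binomial_measure (x - z) (N - y) (b * c).
Proof.
move=> leyN; rewrite /kernelK big_mkord; apply: eq_bigr => z _; congr (_ * _).
have lezx : (z <= x)%N by have := ltn_ord z; lia.
rewrite -binomial_thinning.
rewrite -(big_mkord xpredT (fun j =>
  binomial_measure (x - z) j c * binomial_measure j (N - y) b)).
(* With [j = z1 - y] the kernel sums only over [j >= x - z]; the missing terms of the thinning sum
   vanish. The range must be split at [x - z], so the case where this exceeds [N - y + 1] is treated
   apart: there both sides are zero. *)
have [lexz|ltzx] := leqP (x - z) (N - y).+1; last first.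
  rewrite [LHS]big_geq; last lia.
  rewrite big_nat_cond big1 // => j /andP[/andP[_ ltj] _].
  by rewrite binomial_measure_small ?mul0r //; lia.
rewrite [RHS](big_cat_nat (n := (x - z)%N)) //=.
rewrite [X in _ = X + _]big_nat_cond [X in _ = X + _]big1 => [|j]; last first.
  by move=> /andP[/andP[_ ltj] _]; rewrite binomial_measure_small ?mul0r.
rewrite add0r (_ : x + y - z = (x - z) + y)%N; last lia.
rewrite big_addn (_ : N.+1 - y = (N - y).+1)%N; last lia.
by apply: eq_bigr => j _; rewrite addnK.
Qed.

Lemma kernelK_coef N a b c x y : (y <= N)%N ->
  kernelK N a b c x y =
  (bernoulli_poly a ^+ y * bernoulli_poly (b * c) ^+ (N - y))`_x.
Proof.
move=> leyN; rewrite kernelKE // coefM.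
under [RHS]eq_bigr => z _ do rewrite !coef_bernoulli_polyX.
rewrite -!(big_mkord xpredT (fun z =>
  binomial_measure z y a * binomial_measure (x - z) (N - y) (b * c))).
(* The Cauchy product runs over all [z <= x]; beyond [minn x y] one has [z > y], where the first
   factor is zero. *)
rewrite [RHS](big_cat_nat (n := (minn x y).+1)) //=; last lia.
rewrite [X in _ = _ + X]big_nat_cond [X in _ = _ + X]big1 ?addr0 // => z.
move=> /andP[/andP[ltz1 ltz2] _].
by rewrite binomial_measure_small ?mul0r //; lia.
Qed.

Lemma kernelK_ge0 N a b c x y : 0 < a < 1 -> 0 < b < 1 -> 0 < c < 1 ->
  0 <= kernelK N a b c x y.
Proof.
move=> ha hb hc; apply: sumr_ge0 => z _; apply: mulr_ge0.
  exact: binomial_measure_ge0.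
by apply: sumr_ge0 => j _; apply: mulr_ge0; apply: binomial_measure_ge0.
Qed.

Lemma size_affine_polyX (u v : R) n : (size ((u%:P + v *: 'X) ^+ n)%R <= n.+1)%N.
Proof.
apply: leq_trans (size_poly_exp_leq _ _) _.
have : (size (u%:P + v *: 'X)%R <= 2)%N.
  rewrite (leq_trans (size_polyD _ _)) // geq_max.
  by rewrite (leq_trans (size_polyC_leq1 _)) // (leq_trans (size_scale_leq _ _)) ?size_polyX.
by case: (size _) => [|[|[|]]]; lia.
Qed.

Lemma size_affine_polyM (u v u' v' : R) m n :
  (size ((u%:P + v *: 'X) ^+ m * (u'%:P + v' *: 'X) ^+ n)%R <= (m + n).+1)%N.
Proof.
have := size_polyMleq ((u%:P + v *: 'X) ^+ m) ((u'%:P + v' *: 'X) ^+ n).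
have := size_affine_polyX u v m; have := size_affine_polyX u' v' n; lia.
Qed.

Lemma sum_kernelK N a b c y : (y <= N)%N ->
  \sum_(x < N.+1) kernelK N a b c x y = 1.
Proof.
move=> leyN.
set f := bernoulli_poly a ^+ y * bernoulli_poly (b * c) ^+ (N - y).
(* The degree is at most [y + (N - y) = N], so the sum over [x] exhausts the coefficients. *)
have szf : (size f <= N.+1)%N.
  by rewrite (leq_trans (size_affine_polyM _ _ _ _ _ _)) // subnKC.
transitivity f.[1].
  rewrite (horner_coef_wide _ szf); apply: eq_bigr => x _.
  by rewrite expr1n mulr1 kernelK_coef.
rewrite /f /bernoulli_poly !(hornerE, horner_exp) /=.
by rewrite !subrK !expr1n mulr1.
Qed.

(** * Detailed balance *)

Lemma bin_trinomial N x y z : (z <= x)%N -> (z <= y)%N -> (x + y - z <= N)%N ->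
  ('C(N, y) * ('C(y, z) * 'C(N - y, x - z)) * (z`! * (x - z)`! * (y - z)`!
   * (N - (x + y - z))`!))%N = N`!.
Proof.
move=> lezx lezy leN.
(* The three binomials form a multinomial coefficient with parts [z], [x - z], [y - z] and the rest,
   hence a quantity symmetric in [x] and [y]. *)
have h1 := @bin_fact N y ltac:(lia).
have h2 := @bin_fact y z lezy.
have h3 := @bin_fact (N - y) (x - z) ltac:(lia).
rewrite (_ : N - y - (x - z) = N - (x + y - z))%N in h3; last lia.
rewrite -h1 -h2 -h3; ring.
Qed.

Lemma kernelK_detailed_balance N a b c p x y : (x <= N)%N -> (y <= N)%N ->
  p * (1 - a) = (1 - p) * (b * c) ->
  kernelK N a b c x y * binomial_measure y N p =
  kernelK N a b c y x * binomial_measure x N p.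
Proof.
move=> lexN leyN hp; rewrite !kernelKE // minnC !mulr_suml.
apply: eq_bigr => z _.
have [lezx lezy] : (z <= x)%N /\ (z <= y)%N by have := ltn_ord z; lia.
(* If [x + y - z > N], then [x - z > N - y] and [y - z > N - x], so both terms are zero. *)
have [leN|ltN] := leqP (x + y - z) N; last first.
  by rewrite (@binomial_measure_small _ (x - z)) ?(@binomial_measure_small _ (y - z))
     ?mulr0 ?mul0r //; lia.
have hC : ('C(N, y) * ('C(y, z) * 'C(N - y, x - z)) =
           'C(N, x) * ('C(x, z) * 'C(N - x, y - z)))%N.
  apply/eqP; rewrite -(@eqn_pmul2r (z`! * (x - z)`! * (y - z)`!
   * (N - (x + y - z))`!)%N) ?muln_gt0 ?fact_gt0 //.
  rewrite bin_trinomial //; apply/eqP; rewrite -(@bin_trinomial N y x z) 1?addnC //.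
  ring.
have {}hC := congr1 (fun n : nat => n%:R : R) hC.
rewrite !natrM in hC.
rewrite /binomial_measure.
set i := (x - z)%N in hC *; set j := (y - z)%N in hC *.
set k := (N - (x + y - z))%N.
have -> : (N - y - i = k)%N by rewrite /k /i; lia.
have -> : (N - x - j = k)%N by rewrite /k /j; lia.
have ex : x = (z + i)%N by rewrite /i; lia.
have ey : y = (z + j)%N by rewrite /j; lia.
have eNy : (N - y = i + k)%N by rewrite /k /i; lia.
have eNx : (N - x = j + k)%N by rewrite /k /j; lia.
rewrite eNx eNy in hC *.
have -> : p ^+ y = p ^+ z * p ^+ j by rewrite -exprD -ey.
have -> : p ^+ x = p ^+ z * p ^+ i by rewrite -exprD -ex.
rewrite !exprD.
have hpe m : p ^+ m * (1 - a) ^+ m = (1 - p) ^+ m * (b * c) ^+ m.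
  by rewrite -!exprMn hp.
(* [Q] is common to both sides. Trading [p (1 - a)] for [(1 - p) b c], [j] times on the left and [i]
   times on the right, leaves the same powers of [b * c] and [1 - p]. *)
set Q := a ^+ z * p ^+ z * ((1 - p) ^+ k * (1 - b * c) ^+ k).
transitivity ('C(N, y)%:R * ('C(y, z)%:R * 'C(i + k, i)%:R) * Q *
   (b * c) ^+ i * (p ^+ j * (1 - a) ^+ j) * (1 - p) ^+ i); first by rewrite /Q; ring.
rewrite hC hpe.
transitivity ('C(N, x)%:R * ('C(x, z)%:R * 'C(j + k, j)%:R) * Q *
   (b * c) ^+ j * (p ^+ i * (1 - a) ^+ i) * (1 - p) ^+ j); last by rewrite /Q; ring.
by rewrite hpe; ring.
Qed.

(** * Homogenized evaluation [V^m f(U/V)], written without division *)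

Definition homog_eval (m : nat) (U V f : {poly R}) : {poly R} :=
  \sum_(k < m.+1) f`_k *: (U ^+ k * V ^+ (m - k)).

(** Raising the degree by one supplies the extra [V] that turns the factor [1 + e U/V] into
    [V + e U]. The size bound makes the coefficient of [f] at [m.+1] zero. *)
Lemma homog_evalS m (U V f : {poly R}) e : (size f <= m.+1)%N ->
  homog_eval m.+1 U V ((1%:P + e *: 'X) * f) = (V + e *: U) * homog_eval m U V f.
Proof.
move=> szf; rewrite /homog_eval [RHS]mulrDl !mulr_sumr.
have E k : ((1%:P + e *: 'X) * f)`_k = f`_k + e * (if k == 0%N then 0 else f`_k.-1).
  by rewrite mulrDl mul1r coefD -scalerAl coefZ coefXM.
under eq_bigr => k _ do rewrite E scalerDl.
rewrite big_split /=; congr (_ + _).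
  rewrite big_ord_recr /= nth_default // scale0r addr0.
  apply: eq_bigr => k _; rewrite subSn; last by rewrite -ltnS.
  by rewrite exprS -scalerAr; congr (_ *: _); ring.
rewrite big_ord_recl /= mulr0 scale0r add0r; apply: eq_bigr => k _.
by rewrite /bump /= add1n subSS exprS -scalerAr -scalerAl scalerA mulrC mulrA.
Qed.

Lemma homog_eval_affineX m n (U V : {poly R}) e g :
  homog_eval (m + n) U V ((1%:P + e *: 'X) ^+ m * (1%:P + g *: 'X) ^+ n) =
  (V + e *: U) ^+ m * (V + g *: U) ^+ n.
Proof.
elim: m => [|m IHm].
  rewrite !mul1r add0n; elim: n => [|n IHn].
    by rewrite /homog_eval big_ord1 /= !expr0 coef1 scale1r mulr1.
  by rewrite !exprS homog_evalS ?size_affine_polyX // IHn.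
by rewrite addSn !exprS -!mulrA homog_evalS ?size_affine_polyM // IHm.
Qed.

Lemma coef_affineX (l : R) m i :
  ((1%:P + l *: 'X) ^+ m)`_i = l ^+ i * 'C(m, i)%:R.
Proof.
rewrite exprDn coef_sum.
have E (k : 'I_m.+1) :
    ((1%:P ^+ (m - k) * (l *: 'X) ^+ k) *+ 'C(m, k) : {poly R})`_i =
    if (k == i :> nat)%N then l ^+ i * 'C(m, i)%:R else 0.
  rewrite expr1n mul1r exprZn coefMn coefZ coefXn eq_sym.
  by case: eqP => [->|_]; rewrite ?mulr1 ?mulr_natr ?mulr0n ?mul0rn.
rewrite (eq_bigr _ (fun k _ => E k)) -big_mkcond /=.
have [lei|lti] := leqP i m.
  by rewrite (big_pred1 (Ordinal (lei : (i < m.+1)%N))).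
by rewrite bin_small // mulr0 big1.
Qed.

Lemma coef_homog_eval N n (s l : R) (f : {poly R}) : (n <= N)%N ->
  (homog_eval N (s *: 'X) (1%:P + l *: 'X) f)`_n =
  \sum_(k < n.+1) f`_k * (s ^+ k * l ^+ (n - k) * 'C(N - k, n - k)%:R).
Proof.
move=> lenN; rewrite /homog_eval coef_sum.
have E k : (f`_k *: ((s *: 'X) ^+ k * (1%:P + l *: 'X) ^+ (N - k)))`_n =
  if (k < n.+1)%N then f`_k * (s ^+ k * l ^+ (n - k) * 'C(N - k, n - k)%:R) else 0.
  (* The factor ['X ^+ k] kills every term with [k > n]. *)
  rewrite coefZ exprZn -scalerAl coefZ coefXnM ltnS [(k <= n)%N]leqNgt.
  case: ltnP => [|lekn] /=; first by rewrite !mulr0.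
  by rewrite coef_affineX !mulrA.
under eq_bigr => k _ do rewrite E.
by rewrite -big_mkcond /= -(big_ord_widen _ (fun k =>
  f`_k * (s ^+ k * l ^+ (n - k) * 'C(N - k, n - k)%:R))).
Qed.

(** * Generating function of the Krawtchouk polynomials *)

Lemma pochhammer_oppn n k : pochhammer (- n%:R : R) k = (-1) ^+ k * (n ^_ k)%:R.
Proof.
elim: k => [|k IHk]; first by rewrite /pochhammer big_ord0 expr0 ffactn0 mul1r.
rewrite /pochhammer big_ord_recr /= -/(pochhammer _ k) IHk ffactnSr natrM exprS.
have [lekn|ltnk] := leqP k n; first by rewrite natrB //; ring.
by rewrite ffact_small // !(mul0r, mulr0).
Qed.

Lemma mul_bin_bin N n k : (k <= n)%N -> (n <= N)%N ->
  ('C(N, n) * 'C(n, k) = 'C(N, k) * 'C(N - k, n - k))%N.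
Proof.
move=> lekn lenN; apply/eqP.
rewrite -(@eqn_pmul2r (k`! * (n - k)`! * (N - n)`!)%N) ?muln_gt0 ?fact_gt0 //.
have h1 := bin_fact lenN; have h2 := bin_fact lekn.
have h3 := @bin_fact N k ltac:(lia).
have h4 := @bin_fact (N - k) (n - k) ltac:(lia).
rewrite (_ : N - k - (n - k) = N - n)%N in h4; last lia.
rewrite -h2 in h1; rewrite -h4 in h3; apply/eqP.
transitivity N`!; [rewrite -h1|rewrite -h3]; ring.
Qed.

(** The weight ['C(N, n)] clears the denominator [(-N)_k] and produces exactly the weights of
    [coef_homog_eval] at [s = - p^-1], [l = 1]. *)
Lemma krawtchoukE N n x p : (n <= N)%N ->
  'C(N, n)%:R * krawtchouk N n x p =
  \sum_(k < n.+1) 'C(x, k)%:R * ((- p^-1) ^+ k * 'C(N - k, n - k)%:R).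
Proof.
move=> lenN; rewrite /krawtchouk big_mkord mulr_sumr; apply: eq_bigr => k _.
have lekn : (k <= n)%N by rewrite -ltnS.
have hC := congr1 (fun m : nat => m%:R : R) (mul_bin_bin lekn lenN).
rewrite /= !natrM in hC.
rewrite !pochhammer_oppn -!bin_ffact !natrM [(- p^-1) ^+ k]exprNn -exprVn.
have fk : (k`!%:R : R) != 0 by rewrite pnatr_eq0 -lt0n fact_gt0.
have ck : ('C(N, k)%:R : R) != 0 by rewrite pnatr_eq0 -lt0n bin_gt0 (leq_trans lekn).
have sk : (-1) ^+ k != 0 :> R by rewrite signr_eq0.
move: ((-1) ^+ k) (p^-1 ^+ k) sk => s w sk.
transitivity ('C(N, n)%:R * 'C(n, k)%:R / 'C(N, k)%:R * 'C(x, k)%:R *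
  (s * w)); first by field; rewrite fk ck sk.
by rewrite hC; field.
Qed.

Lemma krawtchouk_gf N n x p l : (x <= N)%N -> (n <= N)%N ->
  ((1%:P + (l * (1 - p^-1)) *: 'X) ^+ x * (1%:P + l *: 'X) ^+ (N - x))`_n =
  l ^+ n * 'C(N, n)%:R * krawtchouk N n x p.
Proof.
move=> lexN lenN; rewrite -mulrA krawtchoukE //.
(* The choice [e = 1], [g = 0] homogenizes [(1 + X)^x], whose coefficients are the ['C(x, k)] of
   [krawtchoukE], to degree [N]. *)
have := homog_eval_affineX x (N - x) ((l * - p^-1) *: 'X) (1%:P + l *: 'X) 1 0.
rewrite subnKC // !scale0r !addr0 !scale1r -addrA -scalerDl.
rewrite (_ : l + l * - p^-1 = l * (1 - p^-1)); last ring.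
move=> <-; rewrite coef_homog_eval // mulr_sumr; apply: eq_bigr => k _.
rewrite expr1n mulr1 -[X in (_ + X) ^+ x]scale1r coef_affineX expr1n mul1r.
have lekn : (k <= n)%N by rewrite -ltnS.
have -> : l ^+ n = l ^+ (n - k) * l ^+ k by rewrite -exprD subnK.
by rewrite exprMn; ring.
Qed.

(** * Binomial moments of the kernel and the eigenvalue equation *)

Lemma kernelK_binomial_moment N a b c x k : (x <= N)%N ->
  \sum_(y < N.+1) kernelK N a b c y x * 'C(y, k)%:R =
  ((1%:P + a *: 'X) ^+ x * (1%:P + (b * c) *: 'X) ^+ (N - x))`_k.
Proof.
move=> lexN.
set G := bernoulli_poly a ^+ x * bernoulli_poly (b * c) ^+ (N - x).
have szG : (size G <= N.+1)%N.
  by rewrite (leq_trans (size_affine_polyM _ _ _ _ _ _)) // subnKC.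
have shift q : bernoulli_poly q \Po (1%:P + 1 *: 'X) = 1%:P + q *: 'X.
  rewrite /bernoulli_poly comp_polyD comp_polyC comp_polyZ comp_polyX.
  by rewrite -!mul_polyC !(rmorphB, rmorph1) /=; ring.
(* The coefficient of [u^k] in [G(1 + u)] weights the [y]-th coefficient of [G] by ['C(y, k)]. *)
transitivity (G \Po (1%:P + 1 *: 'X))`_k; last first.
  by rewrite /G comp_polyM !rmorphXn /= !shift.
rewrite /comp_poly (@horner_coef_wide _ N.+1); last first.
  by rewrite (leq_trans (size_poly _ _)).
rewrite coef_sum; apply: eq_bigr => y _.
by rewrite coef_map coefCM coef_affineX expr1n mul1r kernelK_coef.
Qed.

Lemma sum_kernelK_krawtchouk N a b c p x n : (x <= N)%N -> (n <= N)%N ->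
  p != 0 -> p * (1 - a) = (1 - p) * (b * c) ->
  \sum_(y < N.+1) kernelK N a b c y x * krawtchouk N n y p =
  (a - b * c) ^+ n * krawtchouk N n x p.
Proof.
move=> lexN lenN p0 hp; set d := b * c.
have C0 : ('C(N, n)%:R : R) != 0 by rewrite pnatr_eq0 -lt0n bin_gt0.
apply: (mulfI C0); rewrite mulr_sumr.
set F := (1%:P + a *: 'X) ^+ x * (1%:P + d *: 'X) ^+ (N - x) : {poly R}.
have moment k : \sum_(y < N.+1) kernelK N a b c y x * 'C(y, k)%:R = F`_k.
  exact: kernelK_binomial_moment.
transitivity (homog_eval N ((- p^-1) *: 'X) (1%:P + 1 *: 'X) F)`_n.
  rewrite coef_homog_eval //.
  under eq_bigr => y _ do rewrite mulrCA krawtchoukE // mulr_sumr.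
  rewrite exchange_big /=; apply: eq_bigr => k _.
  rewrite -moment mulr_suml; apply: eq_bigr => y _.
  by rewrite expr1n mulr1 !mulrA.
rewrite -{1}(subnKC lexN) homog_eval_affineX -!addrA !scalerA -!scalerDl.
rewrite [RHS]mulrCA mulrA -krawtchouk_gf //.
(* The two bases agree factor by factor: [1 - a/p = (a - d)(1 - 1/p)] and [1 - d/p = a - d].
   Multiplied by [p], each is a rearrangement of [hp]. *)
congr (nth _ (polyseq (_ ^+ _ * _ ^+ _)) _); congr (_ + _ *: _);
  apply: (mulfI p0); rewrite -/d in hp.
  have -> : p * (1 + a * - p^-1) = p - a by field.
  have -> : p * ((a - d) * (1 - p^-1)) = (a - d) * (p - 1) by field.
  by lra.
have -> : p * (1 + d * - p^-1) = p - d by field.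
by lra.
Qed.

End BinomialGeneratingFunction.

Theorem mainTheorem17 (R : realFieldType) (N : nat) (a b c : R)
    (hN : (1 <= N)%N)
    (ha : 0 < a < 1) (hb : 0 < b < 1) (hc : 0 < c < 1) :
  (forall x y : 'I_N.+1, 0 <= kernelK N a b c x y) /\
  (forall y : 'I_N.+1, \sum_(x < N.+1) kernelK N a b c x y = 1) /\
  let p := b * c / (1 - a + b * c) in
  (forall x y : 'I_N.+1,
     kernelK N a b c x y * binomial_measure y N p =
     kernelK N a b c y x * binomial_measure x N p) /\
  (forall x n : 'I_N.+1,
     \sum_(y < N.+1)
        kernelK N a b c x y * binomial_measure y N p * krawtchouk N n y p =
     (a - b * c) ^+ n * binomial_measure x N p * krawtchouk N n x p).
Proof.
have lebN (i : 'I_N.+1) : (i <= N)%N by rewrite -ltnS.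
split; first by move=> x y; apply: kernelK_ge0.
split; first by move=> y; apply: sum_kernelK.
move=> p.
have [[_ a1] [b0 _] [c0 _]] := And3 (andP ha) (andP hb) (andP hc).
have d0 : 0 < b * c by rewrite mulr_gt0.
have D0 : 1 - a + b * c != 0 by rewrite gt_eqF // addr_gt0 // subr_gt0.
have p0 : p != 0 by rewrite mulf_neq0 ?invr_eq0 // gt_eqF.
have hp : p * (1 - a) = (1 - p) * (b * c) by rewrite /p; field.
split=> [x y|x n]; first exact: kernelK_detailed_balance.
(* Detailed balance transposes the kernel and frees the weight at [x] from the sum. *)
transitivity (binomial_measure x N p *
    \sum_(y < N.+1) kernelK N a b c y x * krawtchouk N n y p).
  rewrite mulr_sumr; apply: eq_bigr => y _.
  by rewrite kernelK_detailed_balance // mulrAC mulrC.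
by rewrite sum_kernelK_krawtchouk // mulrCA mulrA.
Qed.
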